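(* Let $CC$ be a C-system and let $(\mathcal C,p)$ be the universe category with underlying category $\mathcal C=Funct(CC^{op},Rp(Mor(CC)))$ and universe morphism $p:\widetilde O\to O$ described in the context. Then there is an isomorphism of C-systems $H:CC\to CC(\mathcal C,p)$.
   Context: Composition of morphisms is written in diagrammatic order: $f\circ g$ means first $f$, then $g$. **Universe categories.** A universe structure on a morphism $p:\widetilde U\to U$ of a category $\mathcal C$ assigns to every morphism $F:X\to U$ a pull-back square with vertex $(X;F)$ and projections $p_{X,F}:(X;F)\to X$, $Q(F):(X;F)\to\widetilde U$ (so $p_{X,F}\circ F=Q(F)\circ p$). For $f:W\to X$, $g:W\to\widetilde U$ with $f\circ F=g\circ p$, $f*g:W\to (X;F)$ is the unique morphism with $(f*g)\circ p_{X,F}=f$ and $(f*g)\circ Q(F)=g$. For $f:X'\to X$ and $F:X\to U$ put $Q(f,F)=(p_{X',f\circ F}\circ f)*Q(f\circ F):(X';f\circ F)\to(X;F)$. A universe category is a triple $(\mathcal C,p,pt)$, abbreviated $(\mathcal C,p)$, where $p$ is a morphism of $\mathcal C$ equipped with a universe structure and $pt$ is a (chosen) final object of $\mathcal C$. **C-systems.** A C0-system is a (small) category $CC$ with a function $l:Ob(CC)\to\mathbb N$, an object $pt$, a function $ft:Ob(CC)\to Ob(CC)$, for each $X$ a morphism $p_X:X\to ft(X)$, and for each $X$ with $l(X)>0$ and each $f:Y\to ft(X)$ an object $f^*(X)$ and a morphism $q(f,X):f^*(X)\to X$, such that: (1) $l^{-1}(0)=\{pt\}$; (2) $l(ft(X))=l(X)-1$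 if $l(X)>0$; (3) $ft(pt)=pt$; (4) $pt$ is final; (5) if $l(X)>0$ and $f:Y\to ft(X)$ then $l(f^*(X))>0$, $ft(f^*(X))=Y$ and $p_{f^*(X)}\circ f=q(f,X)\circ p_X$; (6) if $l(X)>0$ then $Id_{ft(X)}^*(X)=X$ and $q(Id_{ft(X)},X)=Id_X$; (7) if $l(X)>0$, $f:Y\to ft(X)$, $g:Z\to Y$, then $(g\circ f)^*(X)=g^*(f^*(X))$ and $q(g\circ f,X)=q(g,f^*(X))\circ q(f,X)$. A C-system is a C0-system with an operation assigning to each $f:Y\to X$ with $l(X)>0$ a morphism $s_f:Y\to (f\circ p_X)^*(X)$ such that $s_f\circ p_{(f\circ p_X)^*(X)}=Id_Y$, $f=s_f\circ q(f\circ p_X,X)$, and, whenever $X=g^*(Z)$ with $l(Z)>0$ and $g:ft(X)\to ft(Z)$, $s_f=s_{f\circ q(g,Z)}$. A homomorphism of C-systems is a functor $F$ between the underlying categories (functions on $Ob$ and $Mor$) commuting with $l$ and $ft$ and such that $F(p_X)=p_{F(X)}$ for all $X$, $F(q(f,Y))=q(F(f),F(Y))$ for $l(Y)>0$, $f:X\to ft(Y)$, and $F(s_f)=s_{F(f)}$ for $f:X\to Y$, $l(Y)>0$. It is an isomorphism if it has an inverse homomorphism. **The C-system $CC(\mathcal C,p)$.** Define by induction sets $Ob_n=Ob_n(\mathcal C,p)$ and functions $int:Ob_n\to Ob(\mathcal C)$: $Ob_0=\{tt\}$, $int(tt)=pt$; $Ob_{n+1}=\coprod_{A\in Ob_n}Hom_{\mathcal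 C}(int(A),U)$, $int(A,F)=(int(A);F)$. Then $CC(\mathcal C,p)$ has objects the pairs $(n,A)$, $A\in Ob_n$, with $int(n,A)=int(A)$; morphisms $\Gamma\to\Gamma'$ are the elements $(\Gamma,(\Gamma',a))$ with $a\in Hom_{\mathcal C}(int(\Gamma),int(\Gamma'))$, and $int$ of such a morphism is $a$; identities and composition are those of $\mathcal C$; $l(n,A)=n$; $pt=(0,tt)$; $ft(n+1,(B,F))=(n,B)$, $ft(0,tt)=(0,tt)$; $int(p_{(n+1,(B,F))})=p_{int(B),F}$, $p_{(0,tt)}=Id$; for $\Delta=(n+1,(B,F))$ and $f:(m,A)\to(n,B)$, $f^*(\Delta)=(m+1,(A,int(f)\circ F))$ and $int(q(f,\Delta))=Q(int(f),F)$; the $s$-operation is the unique one making this a C-system. **The category $Rp(M)$.** For a set $M$, $Rp_n(M)$ is the set of subsets of $(\dots(M\times M)\times\dots)\times M$ ($n+1$ factors). $Rp(M)$ is the category with objects the pairs $(n,X)$, $n\ge0$, $X\in Rp_n(M)$, morphisms $(m,X)\to(n,Y)$ the functions $X\to Y$, and the usual identities and composition. **The universe category.** For $\Gamma\in Ob(CC)$ let $Ob_1(\Gamma)=\{\Delta: l(\Delta)=l(\Gamma)+1,\ ft(\Delta)=\Gamma\}$, a presheaf via $\Delta\mapsto f^*(\Delta)$, and let $\widetilde{Ob}_1(\Gamma)\subset Mor(CC)$ be the set of $s:\Gamma\to\Delta$ with $\Delta\in Ob_1(\Gamma)$, $s\circ p_\Delta=Id_\Gamma$, a presheaf via $s\mapsto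 f^*(s)$, where $f^*(s):\Gamma'\to f^*(\Delta)$ is the unique morphism with $f^*(s)\circ p_{f^*(\Delta)}=Id_{\Gamma'}$ and $f^*(s)\circ q(f,\Delta)=f\circ s$. Let $Ob_1'(\Gamma)=\{Id_\Delta:\Delta\in Ob_1(\Gamma)\}\subset Mor(CC)$, with presheaf structure transported from $Ob_1$ along the bijection $Id_\Delta\mapsto\Delta$. In $\mathcal C=Funct(CC^{op},Rp(Mor(CC)))$ put $O(\Gamma)=(0,Ob'_1(\Gamma))$, $\widetilde O(\Gamma)=(0,\widetilde{Ob}_1(\Gamma))$ with these presheaf structures, and $p:\widetilde O\to O$, $s\mapsto Id_{codom(s)}$. For $F:X\to O$ in $\mathcal C$ with $X(\Gamma)=(n,X_0(\Gamma))$ put $(X;F)(\Gamma)=(n+1,\{(x_0,s)\in X_0(\Gamma)\times\widetilde{Ob}_1(\Gamma): F(x_0)=Id_{codom(s)}\})$ with componentwise functoriality, and let $p_{X,F}:(X;F)\to X$, $Q(F):(X;F)\to\widetilde O$ be the two projections; the resulting squares are pull-back squares and form the universe structure on $p$. The chosen final object is the functor $\Gamma\mapsto(0,Mor(\Gamma,pt))$. *)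

(* Defs.v *)
From Stdlib Require Import Arith Lia ProofIrrelevance FunctionalExtensionality.

Set Implicit Arguments.
Unset Strict Implicit.

(** Sets are rendered by types, and [proof_irrelevance] makes every type
    satisfy uniqueness of identity proofs.
    Composition is in diagrammatic order: [f >> g] is first [f], then [g]. *)

Record Category := {
  Ob :> Type;
  Hom : Ob -> Ob -> Type;
  idm : forall X, Hom X X;
  comp : forall X Y Z, Hom X Y -> Hom Y Z -> Hom X Z;
  comp_id_l : forall X Y (f : Hom X Y), comp (idm X) f = f;
  comp_id_r : forall X Y (f : Hom X Y), comp f (idm Y) = f;
  comp_assoc : forall X Y Z W (f : Hom X Y) (g : Hom Y Z) (h : Hom Z W),
    comp (comp f g) h = comp f (comp g h)
}.

Arguments Hom {_} _ _.
Arguments idm {_} _.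
Arguments comp {_ _ _ _} _ _.
Arguments comp_id_l {_ _ _} _.
Arguments comp_id_r {_ _ _} _.
Arguments comp_assoc {_ _ _ _ _} _ _ _.

Notation "f >> g" := (comp f g) (at level 40, left associativity).

(** Morphisms whose domains or codomains are only propositionally equal are
    compared in this type. *)
Definition Mor (C : Category) : Type := {X : C & {Y : C & Hom X Y}}.

Definition mor {C : Category} {X Y : C} (f : Hom X Y) : Mor C :=
  existT _ X (existT _ Y f).

Definition dom {C : Category} (m : Mor C) : C := projT1 m.
Definition codom {C : Category} (m : Mor C) : C := projT1 (projT2 m).
Definition arr {C : Category} (m : Mor C) : Hom (dom m) (codom m) :=
  projT2 (projT2 m).

Definition cast_codom {C : Category} {X Y Y' : C} (e : Y = Y') (f : Hom X Y) :
  Hom X Y' :=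
  match e in _ = Z return Hom X Z with eq_refl => f end.

Definition cast_dom {C : Category} {X X' Y : C} (e : X = X') (f : Hom X Y) :
  Hom X' Y :=
  match e in _ = Z return Hom Z Y with eq_refl => f end.

Definition IsFinal {C : Category} (T : C) : Prop :=
  forall X : C, exists! f : Hom X T, True.

Record Functor (C D : Category) := {
  fob :> C -> D;
  fmor : forall X Y : C, Hom X Y -> Hom (fob X) (fob Y);
  fmor_id : forall X : C, fmor (idm X) = idm (fob X);
  fmor_comp : forall (X Y Z : C) (f : Hom X Y) (g : Hom Y Z),
    fmor (f >> g) = fmor f >> fmor g
}.

Arguments fmor {_ _} _ {_ _} _.

Record NatTrans {C D : Category} (F G : Functor C D) := {
  nt :> forall X : C, Hom (F X) (G X);
  nt_natural : forall (X Y : C) (f : Hom X Y),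
    fmor F f >> nt Y = nt X >> fmor G f
}.

Lemma nt_ext (C D : Category) (F G : Functor C D) (a b : NatTrans F G) :
  (forall X, a X = b X) -> a = b.
Proof.
destruct a as [a Ha], b as [b Hb]; simpl; intros E.
assert (a = b) by (apply functional_extensionality_dep; exact E); subst b.
f_equal; apply proof_irrelevance.
Qed.

Definition nt_id (C D : Category) (F : Functor C D) : NatTrans F F.
Proof.
refine {| nt := fun X => idm (F X) |}.
abstract (intros; now rewrite comp_id_l, comp_id_r).
Defined.

Definition nt_comp (C D : Category) (F G H : Functor C D)
  (a : NatTrans F G) (b : NatTrans G H) : NatTrans F H.
Proof.
refine {| nt := fun X => a X >> b X |}.
abstract (intros; rewrite <- comp_assoc, nt_natural, !comp_assoc;
          now rewrite nt_natural).
Defined.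

Definition Funct (C D : Category) : Category.
Proof.
refine {| Ob := Functor C D; Hom := @NatTrans C D;
          idm := @nt_id C D; comp := @nt_comp C D |}.
- abstract (intros; apply nt_ext; intros; apply comp_id_l).
- abstract (intros; apply nt_ext; intros; apply comp_id_r).
- abstract (intros; apply nt_ext; intros; apply comp_assoc).
Defined.

Definition Op (C : Category) : Category.
Proof.
refine {| Ob := Ob C; Hom := fun X Y => @Hom C Y X; idm := @idm C;
          comp := fun X Y Z f g => @comp C Z Y X g f |}.
- abstract (intros; apply comp_id_r).
- abstract (intros; apply comp_id_l).
- abstract (intros; symmetry; apply comp_assoc).
Defined.

Record C0System := {
  c0_cat :> Category;
  len : c0_cat -> nat;
  cpt : c0_cat;
  ft : c0_cat -> c0_cat;
  pr : forall X : c0_cat, Hom X (ft X);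
  star : forall X : c0_cat, 0 < len X ->
    forall Y : c0_cat, Hom Y (ft X) -> c0_cat;
  q : forall (X : c0_cat) (hX : 0 < len X) (Y : c0_cat) (f : Hom Y (ft X)),
    Hom (star hX f) X;
  len_eq0 : forall X, len X = 0 <-> X = cpt;
  len_ft : forall X, 0 < len X -> len (ft X) = len X - 1;
  ft_cpt : ft cpt = cpt;
  cpt_final : IsFinal cpt;
  len_star : forall X (hX : 0 < len X) Y (f : Hom Y (ft X)),
    0 < len (star hX f);
  ft_star : forall X (hX : 0 < len X) Y (f : Hom Y (ft X)),
    ft (star hX f) = Y;
  q_pr : forall X (hX : 0 < len X) Y (f : Hom Y (ft X)),
    cast_codom (ft_star hX f) (pr (star hX f)) >> f = q hX f >> pr X;
  star_id : forall X (hX : 0 < len X), star hX (idm (ft X)) = X;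
  q_id : forall X (hX : 0 < len X), mor (q hX (idm (ft X))) = mor (idm X);
  star_comp : forall X (hX : 0 < len X) Y (f : Hom Y (ft X)) Z (g : Hom Z Y),
    star hX (g >> f) =
    star (len_star hX f) (cast_codom (eq_sym (ft_star hX f)) g);
  q_comp : forall X (hX : 0 < len X) Y (f : Hom Y (ft X)) Z (g : Hom Z Y),
    mor (q hX (g >> f)) =
    mor (q (len_star hX f) (cast_codom (eq_sym (ft_star hX f)) g) >> q hX f)
}.

Arguments star {_ _} _ {_} _.
Arguments q {_ _} _ {_} _.
Arguments pr {_} _.
Arguments cpt {_}.
Arguments len_star {_ _} _ {_} _.
Arguments ft_star {_ _} _ {_} _.

Record CSystem := {
  cs_c0 :> C0System;
  sop : forall (X : cs_c0) (hX : 0 < len X) (Y : cs_c0) (f : Hom Y X),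
    Hom Y (star hX (f >> pr X));
  sop_pr : forall (X : cs_c0) (hX : 0 < len X) (Y : cs_c0) (f : Hom Y X),
    sop hX f >>
      cast_codom (ft_star hX (f >> pr X)) (pr (star hX (f >> pr X))) = idm Y;
  sop_q : forall (X : cs_c0) (hX : 0 < len X) (Y : cs_c0) (f : Hom Y X),
    f = sop hX f >> q hX (f >> pr X);
  sop_star : forall (X Z : cs_c0) (hX : 0 < len X) (hZ : 0 < len Z)
      (g : Hom (ft X) (ft Z)) (e : X = star hZ g) (Y : cs_c0) (f : Hom Y X),
    mor (sop hX f) = mor (sop hZ (cast_codom e f >> q hZ g))
}.

Arguments sop {_ _} _ {_} _.

(** In [hom_q] and [hom_s] the proof of [0 < len (F Y)], which always exists
    by [hom_len], is quantified over. *)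
Record CSystemHom (CC CC' : CSystem) := {
  hom_functor :> Functor CC CC';
  hom_len : forall X : CC, len (hom_functor X) = len X;
  hom_ft : forall X : CC, hom_functor (ft X) = ft (hom_functor X);
  hom_pr : forall X : CC,
    mor (fmor hom_functor (pr X)) = mor (pr (hom_functor X));
  hom_q : forall (Y : CC) (hY : 0 < len Y) (hFY : 0 < len (hom_functor Y))
      (X : CC) (f : Hom X (ft Y)),
    mor (fmor hom_functor (q hY f)) =
    mor (q hFY (cast_codom (hom_ft Y) (fmor hom_functor f)));
  hom_s : forall (Y : CC) (hY : 0 < len Y) (hFY : 0 < len (hom_functor Y))
      (X : CC) (f : Hom X Y),
    mor (fmor hom_functor (sop hY f)) = mor (sop hFY (fmor hom_functor f))
}.

(** Equality of homomorphisms is equality of the functions on objects and on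
    morphisms. *)
Definition IsIso {CC CC' : CSystem} (H : CSystemHom CC CC') : Prop :=
  exists G : CSystemHom CC' CC,
    (forall X : CC, G (H X) = X) /\
    (forall (X Y : CC) (f : Hom X Y), mor (fmor G (fmor H f)) = mor f) /\
    (forall X : CC', H (G X) = X) /\
    (forall (X Y : CC') (f : Hom X Y), mor (fmor H (fmor G f)) = mor f).

Lemma mor_inj (C : Category) (X Y : C) (f g : Hom X Y) :
  mor f = mor g -> f = g.
Proof.
unfold mor; intros E.
apply EqdepTheory.inj_pair2 in E; now apply EqdepTheory.inj_pair2 in E.
Qed.

Lemma mor_cast_codom (C : Category) (X Y Y' : C) (e : Y = Y') (f : Hom X Y) :
  mor (cast_codom e f) = mor f.
Proof. now destruct e. Qed.

Lemma mor_cast_dom (C : Category) (X X' Y : C) (e : X = X') (f : Hom X Y) :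
  mor (cast_dom e f) = mor f.
Proof. now destruct e. Qed.

Lemma mor_arr (C : Category) (m : Mor C) : mor (arr m) = m.
Proof. now destruct m as [X [Y f]]. Qed.

Lemma mor_eq_inv (C : Category) (X Y X' Y' : C) (f : Hom X Y) (g : Hom X' Y') :
  mor f = mor g ->
  exists (e : X = X') (e' : Y = Y'), cast_codom e' (cast_dom e f) = g.
Proof.
intros E.
assert (eX : X = X') by exact (f_equal dom E).
assert (eY : Y = Y') by exact (f_equal codom E).
subst X' Y'; exists eq_refl, eq_refl; simpl; now apply mor_inj.
Qed.

Lemma mor_comp (C : Category) (X Y Z X' Y' Z' : C)
  (f : Hom X Y) (g : Hom Y Z) (f' : Hom X' Y') (g' : Hom Y' Z') :
  mor f = mor f' -> mor g = mor g' -> mor (f >> g) = mor (f' >> g').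
Proof.
intros Ef Eg.
destruct (mor_eq_inv Ef) as [e [e' <-]]; destruct e, e'; simpl.
destruct (mor_eq_inv Eg) as [d [d' <-]]; destruct d'; simpl.
now rewrite (proof_irrelevance _ d eq_refl).
Qed.

Lemma star_eq (CC : C0System) (X X' Y Y' : CC) (hX : 0 < len X)
  (hX' : 0 < len X') (f : Hom Y (ft X)) (f' : Hom Y' (ft X')) :
  X = X' -> mor f = mor f' -> star hX f = star hX' f'.
Proof.
intros <- E.
assert (Y = Y') as <- by exact (f_equal dom E).
apply mor_inj in E; subst f'; now rewrite (proof_irrelevance _ hX hX').
Qed.

Lemma q_eq (CC : C0System) (X X' Y Y' : CC) (hX : 0 < len X)
  (hX' : 0 < len X') (f : Hom Y (ft X)) (f' : Hom Y' (ft X')) :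
  X = X' -> mor f = mor f' -> mor (q hX f) = mor (q hX' f').
Proof.
intros <- E.
assert (Y = Y') as <- by exact (f_equal dom E).
apply mor_inj in E; subst f'; now rewrite (proof_irrelevance _ hX hX').
Qed.

Lemma sop_eq (CC : CSystem) (X X' Y Y' : CC) (hX : 0 < len X)
  (hX' : 0 < len X') (f : Hom Y X) (f' : Hom Y' X') :
  mor f = mor f' -> mor (sop hX f) = mor (sop hX' f').
Proof.
intros E.
assert (Y = Y') as <- by exact (f_equal dom E).
assert (X = X') as <- by exact (f_equal codom E).
apply mor_inj in E; subst f'; now rewrite (proof_irrelevance _ hX hX').
Qed.

(** The pull-back property is given by its factorization operation, which
    [lift_unique] determines: for [e : f >> F = g >> p], [lift e] is the
    morphism f*g into (X;F) = [cext F]. *)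
Record UniverseStructure (C : Category) (Ut U : C) (p : Hom Ut U) := {
  cext : forall X : C, Hom X U -> C;
  cpr : forall (X : C) (F : Hom X U), Hom (cext F) X;
  cQ : forall (X : C) (F : Hom X U), Hom (cext F) Ut;
  csquare : forall (X : C) (F : Hom X U), cpr F >> F = cQ F >> p;
  lift : forall (X : C) (F : Hom X U) (W : C) (f : Hom W X) (g : Hom W Ut),
    f >> F = g >> p -> Hom W (cext F);
  lift_pr : forall X (F : Hom X U) W (f : Hom W X) (g : Hom W Ut)
    (e : f >> F = g >> p), lift e >> cpr F = f;
  lift_Q : forall X (F : Hom X U) W (f : Hom W X) (g : Hom W Ut)
    (e : f >> F = g >> p), lift e >> cQ F = g;
  lift_unique : forall X (F : Hom X U) W (h h' : Hom W (cext F)),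
    h >> cpr F = h' >> cpr F -> h >> cQ F = h' >> cQ F -> h = h'
}.

Record UniverseCategory := {
  uc_cat :> Category;
  uc_Ut : uc_cat;
  uc_U : uc_cat;
  uc_p : Hom uc_Ut uc_U;
  uc_str : UniverseStructure uc_p;
  uc_pt : uc_cat;
  uc_pt_final : IsFinal uc_pt
}.

Section UniverseCategoryTheory.
Variable C : UniverseCategory.

Local Notation U := (uc_U C).

Definition ext (X : C) (F : Hom X U) : C := cext (uc_str C) F.
Definition extp (X : C) (F : Hom X U) : Hom (ext F) X := cpr (uc_str C) F.
Definition extQ (X : C) (F : Hom X U) : Hom (ext F) (uc_Ut C) :=
  cQ (uc_str C) F.

Lemma ext_unique (X : C) (F : Hom X U) (W : C) (h h' : Hom W (ext F)) :
  h >> extp F = h' >> extp F -> h >> extQ F = h' >> extQ F -> h = h'.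
Proof. exact (@lift_unique _ _ _ _ (uc_str C) X F W h h'). Qed.

Lemma Q2_proof (X' X : C) (f : Hom X' X) (F : Hom X U) :
  (extp (f >> F) >> f) >> F = extQ (f >> F) >> uc_p C.
Proof. rewrite comp_assoc; apply csquare. Qed.

(** This is Q(f,F); the one-argument Q(F) is [extQ F]. *)
Definition Q2 (X' X : C) (f : Hom X' X) (F : Hom X U) :
  Hom (ext (f >> F)) (ext F) :=
  lift (uc_str C) (Q2_proof f F).

Lemma Q2_pr (X' X : C) (f : Hom X' X) (F : Hom X U) :
  Q2 f F >> extp F = extp (f >> F) >> f.
Proof. exact (lift_pr _ (Q2_proof f F)). Qed.

Lemma Q2_Q (X' X : C) (f : Hom X' X) (F : Hom X U) :
  Q2 f F >> extQ F = extQ (f >> F).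
Proof. exact (lift_Q _ (Q2_proof f F)). Qed.

Lemma Q2_comp_pr (X'' X' X : C) (g : Hom X'' X') (f : Hom X' X)
    (F : Hom X U) :
  (Q2 g (f >> F) >> Q2 f F) >> extp F = extp (g >> (f >> F)) >> (g >> f).
Proof.
now rewrite (comp_assoc (Q2 g (f >> F))), Q2_pr,
  <- (comp_assoc (Q2 g (f >> F))), Q2_pr, (comp_assoc (extp _) g f).
Qed.

Lemma Q2_comp_Q (X'' X' X : C) (g : Hom X'' X') (f : Hom X' X)
    (F : Hom X U) :
  (Q2 g (f >> F) >> Q2 f F) >> extQ F = extQ (g >> (f >> F)).
Proof. now rewrite comp_assoc, !Q2_Q. Qed.

Lemma sec_proof (Y X : C) (F : Hom X U) (f : Hom Y (ext F)) :
  idm Y >> ((f >> extp F) >> F) = (f >> extQ F) >> uc_p C.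
Proof.
rewrite comp_id_l, !comp_assoc; f_equal; apply csquare.
Qed.

Definition sec (Y X : C) (F : Hom X U) (f : Hom Y (ext F)) :
  Hom Y (ext ((f >> extp F) >> F)) := lift (uc_str C) (sec_proof f).

Lemma sec_pr (Y X : C) (F : Hom X U) (f : Hom Y (ext F)) :
  sec f >> extp ((f >> extp F) >> F) = idm Y.
Proof. exact (lift_pr _ (sec_proof f)). Qed.

Lemma sec_Q (Y X : C) (F : Hom X U) (f : Hom Y (ext F)) :
  sec f >> extQ ((f >> extp F) >> F) = f >> extQ F.
Proof. exact (lift_Q _ (sec_proof f)). Qed.

Lemma sec_Q2 (Y X : C) (F : Hom X U) (f : Hom Y (ext F)) :
  f = sec f >> Q2 (f >> extp F) F.
Proof.
apply ext_unique.
- now rewrite (comp_assoc (sec f)), Q2_pr, <- (comp_assoc (sec f)), sec_pr,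
    comp_id_l.
- now rewrite (comp_assoc (sec f)), Q2_Q, sec_Q.
Qed.

Lemma sec_eq (Y X : C) (F : Hom X U) (f : Hom Y (ext F))
    (t : Hom Y (ext ((f >> extp F) >> F))) :
  t >> extp ((f >> extp F) >> F) = idm Y ->
  f = t >> Q2 (f >> extp F) F -> t = sec f.
Proof.
intros Ep Eq; apply ext_unique.
- now rewrite sec_pr.
- rewrite sec_Q, <- Q2_Q, <- comp_assoc; now rewrite <- Eq.
Qed.

Lemma sec_Q2_pr (Y V X : C) (F : Hom X U) (g : Hom V X)
    (f : Hom Y (ext (g >> F))) :
  (f >> extp (g >> F)) >> (g >> F) = ((f >> Q2 g F) >> extp F) >> F.
Proof. now rewrite (comp_assoc f (Q2 g F)), Q2_pr, !comp_assoc. Qed.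

Lemma sec_Q2_Q (Y V X : C) (F : Hom X U) (g : Hom V X)
    (f : Hom Y (ext (g >> F))) :
  f >> extQ (g >> F) = (f >> Q2 g F) >> extQ F.
Proof. now rewrite comp_assoc, Q2_Q. Qed.

(** [stage n] is the set Ob_n together with the function int on it. *)
Fixpoint stage (n : nat) : {A : Type & A -> C} :=
  match n with
  | 0 => existT (fun A => A -> C) unit (fun _ => uc_pt C)
  | S n =>
      existT (fun A => A -> C)
        {A : projT1 (stage n) & Hom (projT2 (stage n) A) U}
        (fun AF => ext (projT2 AF))
  end.

Definition Obn (n : nat) : Type := projT1 (stage n).
Definition intn (n : nat) (A : Obn n) : C := projT2 (stage n) A.

Definition cc_ob : Type := {n : nat & Obn n}.
Definition int (X : cc_ob) : C := intn (projT2 X).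

Definition cc_cons (X : cc_ob) (F : Hom (int X) U) : cc_ob :=
  existT Obn (S (projT1 X)) (existT _ (projT2 X) F).

Definition cc_cat : Category.
Proof.
refine {| Ob := cc_ob; Hom := fun X Y => Hom (int X) (int Y);
          idm := fun X => idm (int X); comp := fun X Y Z f g => f >> g |}.
- abstract (intros; apply comp_id_l).
- abstract (intros; apply comp_id_r).
- abstract (intros; apply comp_assoc).
Defined.

Definition cc_len (X : cc_cat) : nat := projT1 X.

Definition cc_pt : cc_cat := existT Obn 0 tt.

Definition cc_ft (X : cc_cat) : cc_cat :=
  let (n, A) := X in
  match n return Obn n -> cc_cat with
  | 0 => fun _ => cc_pt
  | S n => fun BF => existT Obn n (projT1 BF)
  end A.

Definition cc_pr (X : cc_cat) : Hom X (cc_ft X) :=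
  let (n, A) as X return @Hom cc_cat X (cc_ft X) := X in
  match n return forall A : Obn n,
    @Hom cc_cat (existT Obn n A) (cc_ft (existT Obn n A)) with
  | 0 => fun _ => idm (uc_pt C)
  | S n => fun BF => extp (projT2 BF)
  end A.

Definition cc_star (X : cc_cat) :
  0 < cc_len X -> forall Y : cc_cat, Hom Y (cc_ft X) -> cc_cat :=
  let (n, A) as X return
    0 < cc_len X -> forall Y : cc_cat, Hom Y (cc_ft X) -> cc_cat := X in
  match n return forall A : Obn n, 0 < n ->
    forall Y : cc_cat, Hom Y (cc_ft (existT Obn n A)) -> cc_cat with
  | 0 => fun _ h => False_rect _ (Nat.lt_irrefl 0 h)
  | S n => fun BF _ Y (f : Hom (int Y) (intn (projT1 BF))) =>
      cc_cons (f >> projT2 BF)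
  end A.

Definition cc_q (X : cc_cat) : forall (hX : 0 < cc_len X) (Y : cc_cat)
    (f : Hom Y (cc_ft X)), Hom (cc_star hX f) X :=
  let (n, A) as X return forall (hX : 0 < cc_len X) (Y : cc_cat)
    (f : Hom Y (cc_ft X)), @Hom cc_cat (cc_star hX f) X := X in
  match n return forall (A : Obn n) (h : 0 < n) (Y : cc_cat)
    (f : Hom Y (cc_ft (existT Obn n A))),
    @Hom cc_cat (@cc_star (existT Obn n A) h Y f) (existT Obn n A) with
  | 0 => fun _ h => False_rect _ (Nat.lt_irrefl 0 h)
  | S n => fun BF _ Y (f : Hom (int Y) (intn (projT1 BF))) =>
      Q2 f (projT2 BF)
  end A.

Lemma cc_len_eq0 (X : cc_cat) : cc_len X = 0 <-> X = cc_pt.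
Proof.
split; [|intros ->; reflexivity].
destruct X as [[|n] A]; simpl; [|discriminate].
now destruct A.
Qed.

Lemma cc_len_ft (X : cc_cat) : 0 < cc_len X -> cc_len (cc_ft X) = cc_len X - 1.
Proof. destruct X as [[|n] A]; simpl; [lia|]; unfold cc_len; simpl; lia. Qed.

Lemma cc_pt_final : IsFinal cc_pt.
Proof. intros X; exact (@uc_pt_final C (int X)). Qed.

Lemma cc_len_star (X : cc_cat) (hX : 0 < cc_len X) (Y : cc_cat)
  (f : Hom Y (cc_ft X)) : 0 < cc_len (cc_star hX f).
Proof.
destruct X as [[|n] A]; [exfalso; exact (Nat.lt_irrefl 0 hX)|].
apply Nat.lt_0_succ.
Qed.

Lemma cc_ft_star (X : cc_cat) (hX : 0 < cc_len X) (Y : cc_cat)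
  (f : Hom Y (cc_ft X)) : cc_ft (cc_star hX f) = Y.
Proof.
destruct X as [[|n] A]; [exfalso; exact (Nat.lt_irrefl 0 hX)|].
now destruct Y.
Qed.

Lemma cc_q_pr (X : cc_cat) (hX : 0 < cc_len X) (Y : cc_cat)
  (f : Hom Y (cc_ft X)) :
  cast_codom (cc_ft_star hX f) (cc_pr (cc_star hX f)) >> f =
  cc_q hX f >> cc_pr X.
Proof.
generalize (cc_ft_star hX f).
destruct X as [[|n] A0]; [exfalso; exact (Nat.lt_irrefl 0 hX)|];
  destruct A0 as [B F].
destruct Y as [m A]; intros e.
rewrite (proof_irrelevance _ e eq_refl).
symmetry; exact (lift_pr (uc_str C) (Q2_proof f F)).
Qed.

Lemma cc_star_id (X : cc_cat) (hX : 0 < cc_len X) :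
  cc_star hX (idm (cc_ft X)) = X.
Proof.
destruct X as [[|n] A0]; [exfalso; exact (Nat.lt_irrefl 0 hX)|];
  destruct A0 as [B F].
exact (f_equal (@cc_cons (existT Obn n B)) (comp_id_l F)).
Qed.

Lemma cc_q_unique (X Y : cc_cat) (F : Hom (int X) U) (F' : Hom (int Y) U)
    (f : Hom (int Y) (int X)) (h : Hom (ext F') (ext F))
    (e : F' = f >> F) :
  h >> extp F = extp F' >> f -> h >> extQ F = extQ F' ->
  @mor cc_cat (cc_cons F') (cc_cons F) h =
  @mor cc_cat (cc_cons (f >> F)) (cc_cons F) (Q2 f F).
Proof.
subst F'; intros Hp HQ; f_equal; f_equal.
apply ext_unique.
- etransitivity; [exact Hp|]; symmetry; apply Q2_pr.
- etransitivity; [exact HQ|]; symmetry; apply Q2_Q.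
Qed.

Lemma cc_q_id (X : cc_cat) (hX : 0 < cc_len X) :
  mor (cc_q hX (idm (cc_ft X))) = mor (idm X).
Proof.
destruct X as [[|n] A0]; [exfalso; exact (Nat.lt_irrefl 0 hX)|];
  destruct A0 as [B F].
symmetry.
apply (@cc_q_unique (existT Obn n B) (existT Obn n B) F F (@idm C (intn B))).
- symmetry; apply comp_id_l.
- exact (eq_trans (comp_id_l (extp F)) (eq_sym (comp_id_r (extp F)))).
- exact (comp_id_l (extQ F)).
Qed.

Lemma cc_star_comp (X : cc_cat) (hX : 0 < cc_len X) (Y : cc_cat)
  (f : Hom Y (cc_ft X)) (Z : cc_cat) (g : Hom Z Y) :
  cc_star hX (g >> f) =
  cc_star (cc_len_star hX f) (cast_codom (eq_sym (cc_ft_star hX f)) g).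
Proof.
generalize (cc_ft_star hX f) (cc_len_star hX f).
destruct X as [[|n] A0]; [exfalso; exact (Nat.lt_irrefl 0 hX)|];
  destruct A0 as [B F].
destruct Y as [m A]; intros e h.
rewrite (proof_irrelevance _ e eq_refl).
apply (f_equal (@cc_cons Z)).
exact (@comp_assoc C (int Z) (intn A) (intn B) _ g f F).
Qed.

Lemma cc_q_comp (X : cc_cat) (hX : 0 < cc_len X) (Y : cc_cat)
  (f : Hom Y (cc_ft X)) (Z : cc_cat) (g : Hom Z Y) :
  mor (cc_q hX (g >> f)) =
  mor (cc_q (cc_len_star hX f) (cast_codom (eq_sym (cc_ft_star hX f)) g)
       >> cc_q hX f).
Proof.
generalize (cc_ft_star hX f) (cc_len_star hX f).
destruct X as [[|n] A0]; [exfalso; exact (Nat.lt_irrefl 0 hX)|];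
  destruct A0 as [B F].
destruct Y as [m A]; intros e h.
rewrite (proof_irrelevance _ e eq_refl).
symmetry.
change (@Hom C (int Z) (intn A)) in g; change (@Hom C (intn A) (intn B)) in f.
apply (@cc_q_unique (existT Obn n B) Z F (g >> (f >> F)) (g >> f)
         (Q2 g (f >> F) >> Q2 f F)).
- symmetry; exact (comp_assoc g f F).
- exact (Q2_comp_pr g f F).
- exact (Q2_comp_Q g f F).
Qed.

Definition cc_c0 : C0System :=
  {| c0_cat := cc_cat; len := cc_len; cpt := cc_pt; ft := cc_ft;
     pr := cc_pr; star := cc_star; q := cc_q; len_eq0 := cc_len_eq0;
     len_ft := cc_len_ft; ft_cpt := eq_refl; cpt_final := cc_pt_final;
     len_star := cc_len_star; ft_star := cc_ft_star; q_pr := cc_q_pr;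
     star_id := cc_star_id; q_id := cc_q_id; star_comp := cc_star_comp;
     q_comp := cc_q_comp |}.

Definition cc_s (X : cc_cat) : forall (hX : 0 < cc_len X) (Y : cc_cat)
    (f : Hom Y X), Hom Y (cc_star hX (f >> cc_pr X)) :=
  let (n, A) as X return forall (hX : 0 < cc_len X) (Y : cc_cat)
    (f : Hom Y X), @Hom cc_cat Y (cc_star hX (f >> cc_pr X)) := X in
  match n return forall (A : Obn n) (h : 0 < n) (Y : cc_cat)
    (f : Hom Y (existT Obn n A : cc_cat)),
    @Hom cc_cat Y
      (@cc_star (existT Obn n A) h Y (f >> cc_pr (existT Obn n A))) with
  | 0 => fun _ h => False_rect _ (Nat.lt_irrefl 0 h)
  | S n => fun BF _ Y (f : Hom (int Y) (ext (projT2 BF))) => sec f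
  end A.

Lemma cc_s_pr (X : cc_c0) (hX : 0 < len X) (Y : cc_c0) (f : Hom Y X) :
  cc_s hX f >>
    cast_codom (ft_star hX (f >> pr X)) (pr (star hX (f >> pr X))) = idm Y.
Proof.
generalize (ft_star hX (f >> pr X)).
destruct X as [[|n] A0]; [exfalso; exact (Nat.lt_irrefl 0 hX)|];
  destruct A0 as [B F].
destruct Y as [m A]; intros e.
rewrite (proof_irrelevance _ e eq_refl).
exact (lift_pr _ (sec_proof (f : Hom (intn A) (ext F)))).
Qed.

Lemma cc_s_q (X : cc_c0) (hX : 0 < len X) (Y : cc_c0) (f : Hom Y X) :
  f = cc_s hX f >> q hX (f >> pr X).
Proof.
destruct X as [[|n] A0]; [exfalso; exact (Nat.lt_irrefl 0 hX)|];
  destruct A0 as [B F].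
change (@Hom C (int Y) (ext F)) in f.
change (f = sec f >> Q2 (f >> extp F) F).
apply sec_Q2.
Qed.

(** The two conditions [cc_s_pr] and [cc_s_q] determine [cc_s]. *)
Lemma cc_s_eq (X : cc_c0) (hX : 0 < len X) (Y : cc_c0) (f : Hom Y X)
    (t : Hom Y (star hX (f >> pr X))) :
  t >> cast_codom (ft_star hX (f >> pr X)) (pr (star hX (f >> pr X))) = idm Y ->
  f = t >> q hX (f >> pr X) -> t = cc_s hX f.
Proof.
generalize (ft_star hX (f >> pr X)).
destruct X as [[|n] A0]; [exfalso; exact (Nat.lt_irrefl 0 hX)|];
  destruct A0 as [B F].
destruct Y as [m A]; intros e.
rewrite (proof_irrelevance _ e eq_refl).
exact (@sec_eq (intn A) (intn B) F f t).
Qed.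

Lemma sec_unique (Y X X' : cc_cat) (F : Hom (int X) U) (F' : Hom (int X') U)
    (f : Hom (int Y) (ext F)) (f' : Hom (int Y) (ext F')) :
  (f >> extp F) >> F = (f' >> extp F') >> F' -> f >> extQ F = f' >> extQ F' ->
  @mor cc_cat Y (@cc_cons Y ((f >> extp F) >> F)) (sec f) =
  @mor cc_cat Y (@cc_cons Y ((f' >> extp F') >> F')) (sec f').
Proof.
unfold sec; generalize (sec_proof f) (sec_proof f').
generalize ((f >> extp F) >> F) ((f' >> extp F') >> F').
intros G G' e e' <- E; destruct E.
now rewrite (proof_irrelevance _ e e').
Qed.

Lemma cc_s_star (X Z : cc_c0) (hX : 0 < len X) (hZ : 0 < len Z)
    (g : Hom (ft X) (ft Z)) (e : X = star hZ g) (Y : cc_c0) (f : Hom Y X) :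
  mor (cc_s hX f) = mor (cc_s hZ (cast_codom e f >> q hZ g)).
Proof.
assert (G : forall (V : cc_c0) (g : Hom V (ft Z)) (e : X = star hZ g),
          mor (cc_s hX f) = mor (cc_s hZ (cast_codom e f >> q hZ g)));
  [|apply G].
clear g e; intros V g e; subst X; simpl cast_codom.
destruct Z as [[|n] A0]; [exfalso; exact (Nat.lt_irrefl 0 hZ)|];
  destruct A0 as [B F].
change (@Hom C (int V) (intn B)) in g.
change (@Hom C (int Y) (ext (g >> F))) in f.
apply (@sec_unique Y V (existT Obn n B) (g >> F) F f (f >> Q2 g F)).
- exact (sec_Q2_pr f).
- exact (sec_Q2_Q f).
Qed.

Definition CC_of_universe : CSystem :=
  {| cs_c0 := cc_c0; sop := cc_s; sop_pr := cc_s_pr; sop_q := cc_s_q;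
     sop_star := cc_s_star |}.

End UniverseCategoryTheory.

Fixpoint pow (M : Type) (n : nat) : Type :=
  match n with
  | 0 => M
  | S n => (pow M n * M)%type
  end.

Definition Rpn (M : Type) (n : nat) : Type := pow M n -> Prop.

Definition rp_ob (M : Type) : Type := {n : nat & Rpn M n}.

Definition el {M : Type} (X : rp_ob M) : Type :=
  {x : pow M (projT1 X) | projT2 X x}.

Definition Rp (M : Type) : Category :=
  {| Ob := rp_ob M;
     Hom := fun X Y => el X -> el Y;
     idm := fun X x => x;
     comp := fun X Y Z f g x => g (f x);
     comp_id_l := fun X Y f => eq_refl;
     comp_id_r := fun X Y f => eq_refl;
     comp_assoc := fun X Y Z W f g h => eq_refl |}.

Lemma el_ext (M : Type) (X : rp_ob M) (x y : el X) :
  proj1_sig x = proj1_sig y -> x = y.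
Proof.
destruct x as [x hx], y as [y hy]; simpl; intros <-.
f_equal; apply proof_irrelevance.
Qed.

Section Presheaves.
Variable CC : CSystem.

Local Notation M := (Mor CC).

Definition Ob1 (G D : CC) : Prop := len D = len G + 1 /\ ft D = G.

Lemma Ob1_pos (G D : CC) : Ob1 G D -> 0 < len D.
Proof. intros [h _]; lia. Qed.

Definition pb1 (G' G : CC) (f : Hom G' G) (D : CC) (d : Ob1 G D) : CC :=
  star (Ob1_pos d) (cast_codom (eq_sym (proj2 d)) f).

Lemma pb1_Ob1 (G' G : CC) (f : Hom G' G) (D : CC) (d : Ob1 G D) :
  Ob1 G' (pb1 f d).
Proof.
assert (e : ft (pb1 f d) = G') by apply ft_star.
assert (h : 0 < len (pb1 f d)) by apply len_star.
split; [|exact e].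
pose proof (len_ft h) as E; rewrite e in E; lia.
Qed.

Lemma pb1_id (G D : CC) (d : Ob1 G D) : pb1 (idm G) d = D.
Proof.
etransitivity; [|exact (star_id (Ob1_pos d))].
apply star_eq; [reflexivity|].
rewrite mor_cast_codom; now rewrite (proj2 d).
Qed.

Lemma pb1_comp (G'' G' G : CC) (g : Hom G'' G') (f : Hom G' G) (D : CC)
    (d : Ob1 G D) (d' : Ob1 G' (pb1 f d)) : pb1 (g >> f) d = pb1 g d'.
Proof.
transitivity (star (Ob1_pos d) (g >> cast_codom (eq_sym (proj2 d)) f)).
- apply star_eq; [reflexivity|].
  rewrite mor_cast_codom; apply mor_comp; now rewrite ?mor_cast_codom.
- rewrite star_comp; apply star_eq; [reflexivity|].
  now rewrite !mor_cast_codom.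
Qed.

Lemma pb1_eq (G' G D D' : CC) (f : Hom G' G) (d : Ob1 G D) (d' : Ob1 G D') :
  D = D' -> pb1 f d = pb1 f d'.
Proof. intros <-; now rewrite (proof_irrelevance _ d d'). Qed.

Definition Ob1' (G : CC) (m : M) : Prop :=
  exists D : CC, Ob1 G D /\ m = mor (idm D).

Lemma Ob1'_dom (G : CC) (m : M) : Ob1' G m -> Ob1 G (dom m).
Proof. now intros [D [d ->]]. Qed.

Lemma Ob1'_idm (G D : CC) : Ob1 G D -> Ob1' G (mor (idm D)).
Proof. intros d; now exists D. Qed.

Definition tOb1 (G : CC) (s : M) : Prop :=
  dom s = G /\ Ob1 G (codom s) /\ mor (arr s >> pr (codom s)) = mor (idm G).

(** The section f^*(s) of f^*(D).  [pb_sec_pr] and [pb_sec_q] are its defining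
    equations and [pb_sec_eq] says that they determine it. *)
Definition pb_sec (G' G : CC) (f : Hom G' G) (D : CC) (d : Ob1 G D)
    (s : Hom G D) : M :=
  mor (sop (Ob1_pos d) (f >> s)).

Section PbSec.
Variables (G' G : CC) (f : Hom G' G) (D : CC) (d : Ob1 G D) (s : Hom G D).
Hypothesis hs : mor (s >> pr D) = mor (idm G).

Lemma pb_sec_proj : mor ((f >> s) >> pr D) = mor f.
Proof.
rewrite comp_assoc.
transitivity (mor (f >> idm G)); [|now rewrite comp_id_r].
now apply mor_comp.
Qed.

Lemma pb_sec_dom : dom (pb_sec f d s) = G'.
Proof. reflexivity. Qed.

Lemma pb_sec_star :
  star (Ob1_pos d) ((f >> s) >> pr D) = pb1 f d.
Proof.
apply star_eq; [reflexivity|].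
rewrite mor_cast_codom; apply pb_sec_proj.
Qed.

Lemma pb_sec_codom : codom (pb_sec f d s) = pb1 f d.
Proof. exact pb_sec_star. Qed.

Lemma pb_sec_pr :
  mor (arr (pb_sec f d s) >> pr (codom (pb_sec f d s))) = mor (idm G').
Proof.
unfold pb_sec; simpl.
rewrite <- (sop_pr (Ob1_pos d) (f >> s)).
apply mor_comp; [reflexivity|]; now rewrite mor_cast_codom.
Qed.

Lemma pb_sec_q :
  mor (cast_codom pb_sec_codom (arr (pb_sec f d s)) >>
       q (Ob1_pos d) (cast_codom (eq_sym (proj2 d)) f)) =
  mor (f >> s).
Proof.
etransitivity; [|exact (f_equal mor (eq_sym (sop_q (Ob1_pos d) (f >> s))))].
apply mor_comp; [now rewrite mor_cast_codom|].
apply q_eq; [reflexivity|].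
rewrite mor_cast_codom; symmetry; apply pb_sec_proj.
Qed.

Lemma pb_sec_tOb1 : tOb1 G' (pb_sec f d s).
Proof.
split; [reflexivity|split; [|exact pb_sec_pr]].
rewrite pb_sec_codom; apply pb1_Ob1.
Qed.

End PbSec.

Lemma sop_section (G D : CC) (d : Ob1 G D) (s : Hom G D) :
  mor (s >> pr D) = mor (idm G) -> mor (sop (Ob1_pos d) s) = mor s.
Proof.
intros hs.
etransitivity; [|exact (f_equal mor (eq_sym (sop_q (Ob1_pos d) s)))].
etransitivity; [exact (f_equal mor (eq_sym (comp_id_r (sop (Ob1_pos d) s))))|].
apply mor_comp; [reflexivity|].
assert (E : star (Ob1_pos d) (s >> pr D) = D).
{ etransitivity; [|exact (star_id (Ob1_pos d))].
  apply star_eq; [reflexivity|].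
  rewrite hs; now rewrite (proj2 d). }
transitivity (mor (idm D)); [now rewrite E|].
rewrite <- (q_id (Ob1_pos d)); apply q_eq; [reflexivity|].
rewrite hs; now rewrite (proj2 d).
Qed.

Lemma sop_comp_q (X Z : CC) (hX : 0 < len X) (hZ : 0 < len Z) (V : CC)
    (g : Hom V (ft Z)) (e : X = star hZ g) (Y : CC) (f : Hom Y X) :
  mor (sop hX f) = mor (sop hZ (cast_codom e f >> q hZ g)).
Proof.
assert (eV : V = ft X) by (rewrite e; symmetry; apply ft_star).
destruct (eq_sym eV).
apply sop_star.
Qed.

Lemma pb_sec_eq (G' G : CC) (f : Hom G' G) (D : CC) (d : Ob1 G D)
    (s : Hom G D) (t : Hom G' (pb1 f d)) :
  mor (t >> pr (pb1 f d)) = mor (idm G') ->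
  t >> q (Ob1_pos d) (cast_codom (eq_sym (proj2 d)) f) = f >> s ->
  mor t = pb_sec f d s.
Proof.
intros ht hq.
rewrite <- (sop_section (pb1_Ob1 f d) ht).
unfold pb_sec; rewrite <- hq.
exact (sop_comp_q (Ob1_pos (pb1_Ob1 f d))
  (eq_refl : pb1 f d = star (Ob1_pos d) _) t).
Qed.

Lemma pb_sec_mor (G' G : CC) (f : Hom G' G) (D D' : CC) (d : Ob1 G D)
    (d' : Ob1 G D') (s : Hom G D) (s' : Hom G D') :
  mor s = mor s' -> pb_sec f d s = pb_sec f d' s'.
Proof. intros E; apply sop_eq, mor_comp; [reflexivity|exact E]. Qed.

Lemma pb_sec_id (G D : CC) (d : Ob1 G D) (s : Hom G D) :
  mor (s >> pr D) = mor (idm G) -> pb_sec (idm G) d s = mor s.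
Proof.
intros hs; unfold pb_sec; rewrite comp_id_l; now apply sop_section.
Qed.

Lemma pb_sec_comp (G'' G' G : CC) (g : Hom G'' G') (f : Hom G' G) (D D' : CC)
    (d : Ob1 G D) (d' : Ob1 G' D') (s : Hom G D) (s' : Hom G' D') :
  mor (s >> pr D) = mor (idm G) -> mor s' = pb_sec f d s ->
  pb_sec (g >> f) d s = pb_sec g d' s'.
Proof.
intros hs hs'; unfold pb_sec; symmetry.
assert (e : D' = pb1 f d).
{ etransitivity; [exact (f_equal codom hs')|]; now apply pb_sec_codom. }
rewrite (sop_comp_q (Ob1_pos d') (e : D' = star (Ob1_pos d) _) (g >> s')).
apply sop_eq; rewrite comp_assoc.
transitivity
  (mor (g >> (cast_codom e s' >>
              q (Ob1_pos d) (cast_codom (eq_sym (proj2 d)) f)))).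
- rewrite <- comp_assoc; apply mor_comp; [|reflexivity].
  rewrite mor_cast_codom; apply mor_comp; now rewrite ?mor_cast_codom.
- apply mor_comp; [reflexivity|].
  rewrite <- (pb_sec_q f d hs).
  apply mor_comp; [|reflexivity].
  now rewrite !mor_cast_codom, mor_arr.
Qed.

Definition Psh : Category := Funct (Op CC) (Rp M).

Definition O_ob (G : CC) : Rp M := existT (Rpn M) 0 (Ob1' G).

Definition O_map (G' G : CC) (f : Hom G' G) (x : el (O_ob G)) : el (O_ob G') :=
  exist (Ob1' G') (mor (idm (pb1 f (Ob1'_dom (proj2_sig x)))))
    (Ob1'_idm (pb1_Ob1 f (Ob1'_dom (proj2_sig x)))).

Definition psh_O : Psh.
Proof.
refine {| fob := (O_ob : Op CC -> Rp M);
          fmor := fun (G G' : Op CC) (f : Hom G G') => @O_map G' G f |}.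
- abstract (intros G; apply functional_extensionality; intros [m h];
    apply el_ext; simpl; rewrite pb1_id; destruct h as [D [d ->]];
    reflexivity).
- abstract (intros G G' G'' f g; apply functional_extensionality; intros [m h];
    apply el_ext; simpl; apply (f_equal (fun D => mor (idm D)));
    apply pb1_comp).
Defined.

Definition tO_ob (G : CC) : Rp M := existT (Rpn M) 0 (tOb1 G).

Definition sec_of (G : CC) (s : M) (h : tOb1 G s) : Hom G (codom s) :=
  cast_dom (proj1 h) (arr s).

Lemma mor_sec_of (G : CC) (s : M) (h : tOb1 G s) : mor (sec_of h) = s.
Proof. unfold sec_of; now rewrite mor_cast_dom, mor_arr. Qed.

Lemma sec_of_pr (G : CC) (s : M) (h : tOb1 G s) :
  mor (sec_of h >> pr (codom s)) = mor (idm G).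
Proof.
rewrite <- (proj2 (proj2 h)); apply mor_comp; [|reflexivity].
now rewrite mor_sec_of, mor_arr.
Qed.

Definition tO_map (G' G : CC) (f : Hom G' G) (x : el (tO_ob G)) :
  el (tO_ob G') :=
  let h : tOb1 G (proj1_sig x) := proj2_sig x in
  exist (tOb1 G') (pb_sec f (proj1 (proj2 h)) (sec_of h))
    (pb_sec_tOb1 f (proj1 (proj2 h)) (sec_of_pr h)).

Definition psh_tO : Psh.
Proof.
refine {| fob := (tO_ob : Op CC -> Rp M);
          fmor := fun (G G' : Op CC) (f : Hom G G') => @tO_map G' G f |}.
- abstract (intros G; apply functional_extensionality; intros [s h];
    apply el_ext; simpl;
    exact (eq_trans (pb_sec_id (proj1 (proj2 h)) (sec_of_pr h))
             (mor_sec_of h))).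
- abstract (intros G G' G'' f g; apply functional_extensionality; intros [s h];
    apply el_ext; simpl; apply pb_sec_comp;
    [apply sec_of_pr | apply mor_sec_of]).
Defined.

Definition p_map (G : CC) (x : el (tO_ob G)) : el (O_ob G) :=
  exist (Ob1' G) (mor (idm (codom (proj1_sig x))))
    (Ob1'_idm (proj1 (proj2 (proj2_sig x : tOb1 G (proj1_sig x))))).

Definition univ_p : @Hom Psh psh_tO psh_O.
Proof.
refine (@Build_NatTrans (Op CC) (Rp M) psh_tO psh_O (fun G : Op CC => @p_map G) _).
abstract (intros G G' f; apply functional_extensionality; intros [s h];
  apply el_ext; simpl; apply (f_equal (fun D => mor (idm D)));
  etransitivity; [exact (pb_sec_star f (proj1 (proj2 h)) (sec_of_pr h))|];
  now apply pb1_eq).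
Defined.

Section Extension.
Variables (X : Psh) (F : @Hom Psh X psh_O).

Local Notation Xf := (X : Functor (Op CC) (Rp M)).
Local Notation Ff := (F : NatTrans X psh_O).

Definition e_ob (G : CC) : Rp M :=
  existT (Rpn M) (S (projT1 (Xf G)))
    (fun z : pow M (projT1 (Xf G)) * M =>
       exists h : projT2 (Xf G) (fst z),
         tOb1 G (snd z) /\
         proj1_sig (Ff G (exist _ (fst z) h)) = mor (idm (codom (snd z)))).

Definition e_fst (G : CC) (z : el (e_ob G)) : el (Xf G) :=
  exist (projT2 (Xf G)) (fst (proj1_sig z))
    (match proj2_sig z with ex_intro _ h _ => h end).

Definition e_snd (G : CC) (z : el (e_ob G)) : el (tO_ob G) :=
  exist (tOb1 G) (snd (proj1_sig z))
    (match proj2_sig z with ex_intro _ _ h => proj1 h end).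

Lemma e_cond (G : CC) (z : el (e_ob G)) : Ff G (e_fst z) = p_map (e_snd z).
Proof.
apply el_ext; destruct z as [z [h [h1 h2]]]; exact h2.
Qed.

Definition e_mk (G : CC) (x : el (Xf G)) (s : el (tO_ob G))
    (e : Ff G x = p_map s) : el (e_ob G).
Proof.
refine (exist (projT2 (e_ob G)) (proj1_sig x, proj1_sig s) _).
abstract (simpl; exists (proj2_sig x); split; [exact (proj2_sig s)|];
  destruct x as [x hx]; exact (f_equal (@proj1_sig _ _) e)).
Defined.

Lemma e_map_cond (G G' : CC) (f : Hom G' G) (z : el (e_ob G)) :
  Ff G' (fmor Xf (f : @Hom (Op CC) G G') (e_fst z)) =
  p_map (tO_map f (e_snd z)).
Proof.
pose proof (nt_natural Ff (f : @Hom (Op CC) G G')) as E1.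
pose proof (nt_natural (univ_p : NatTrans psh_tO psh_O) (f : @Hom (Op CC) G G')) as E2.
etransitivity; [exact (f_equal (fun k => k (e_fst z)) E1)|].
symmetry; etransitivity; [exact (f_equal (fun k => k (e_snd z)) E2)|].
symmetry; exact (f_equal (O_map f) (e_cond z)).
Qed.

Definition e_map (G G' : CC) (f : Hom G' G) (z : el (e_ob G)) : el (e_ob G') :=
  e_mk (e_map_cond f z).

Lemma e_ext (G : CC) (z z' : el (e_ob G)) :
  e_fst z = e_fst z' -> e_snd z = e_snd z' -> z = z'.
Proof.
intros E1 E2; apply el_ext.
apply (f_equal (@proj1_sig _ _)) in E1; apply (f_equal (@proj1_sig _ _)) in E2.
simpl in E1, E2.
rewrite (surjective_pairing (proj1_sig z)), (surjective_pairing (proj1_sig z')).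
f_equal; assumption.
Qed.

Lemma e_fst_mk (G : CC) x s e : e_fst (@e_mk G x s e) = x.
Proof. now apply el_ext. Qed.

Lemma e_snd_mk (G : CC) x s e : e_snd (@e_mk G x s e) = s.
Proof. now apply el_ext. Qed.

Definition e_psh : Psh.
Proof.
refine {| fob := (e_ob : Op CC -> Rp M);
          fmor := fun (G G' : Op CC) (f : Hom G G') => @e_map G G' f |}.
- abstract (intros G; apply functional_extensionality; intros z;
    apply e_ext; unfold e_map; [rewrite e_fst_mk | rewrite e_snd_mk];
    [exact (f_equal (fun k => k (e_fst z)) (fmor_id Xf G))
    |exact (f_equal (fun k => k (e_snd z))
              (fmor_id (psh_tO : Functor (Op CC) (Rp M)) G))]).
- abstract (intros G G' G'' f g; apply functional_extensionality; intros z;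
    apply e_ext; simpl; unfold e_map;
    [rewrite !e_fst_mk | rewrite !e_snd_mk];
    [exact (f_equal (fun k => k (e_fst z)) (fmor_comp Xf f g))
    |exact (f_equal (fun k => k (e_snd z))
              (fmor_comp (psh_tO : Functor (Op CC) (Rp M)) f g))]).
Defined.

Definition e_pr : @Hom Psh e_psh X.
Proof.
refine (@Build_NatTrans (Op CC) (Rp M) e_psh X (fun G : Op CC => @e_fst G) _).
abstract (intros G G' f; apply functional_extensionality; intros z;
  apply e_fst_mk).
Defined.

Definition e_Q : @Hom Psh e_psh psh_tO.
Proof.
refine (@Build_NatTrans (Op CC) (Rp M) e_psh psh_tO (fun G : Op CC => @e_snd G) _).
abstract (intros G G' f; apply functional_extensionality; intros z;
  apply e_snd_mk).
Defined.

Lemma e_square : e_pr >> F = e_Q >> univ_p.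
Proof.
apply nt_ext; intros G; apply functional_extensionality; intros z.
exact (e_cond z).
Qed.

Definition e_lift (W : Psh) (f : Hom W X) (g : Hom W psh_tO)
    (e : f >> F = g >> univ_p) : Hom W e_psh.
Proof.
refine (@Build_NatTrans (Op CC) (Rp M) W e_psh (fun (G : Op CC) w =>
          @e_mk G ((f : NatTrans W X) G w) ((g : NatTrans W psh_tO) G w)
            (f_equal (fun k : NatTrans W psh_O => k G w) e)) _).
abstract (intros G G' k; apply functional_extensionality; intros w;
  apply e_ext; simpl; unfold e_map; [rewrite !e_fst_mk | rewrite !e_snd_mk];
  [exact (f_equal (fun t => t w) (nt_natural (f : NatTrans W X) k))
  |exact (f_equal (fun t => t w) (nt_natural (g : NatTrans W psh_tO) k))]).
Defined.

Lemma e_lift_pr (W : Psh) (f : Hom W X) (g : Hom W psh_tO)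
    (e : f >> F = g >> univ_p) : e_lift e >> e_pr = f.
Proof.
apply nt_ext; intros G; apply functional_extensionality; intros w.
apply e_fst_mk.
Qed.

Lemma e_lift_Q (W : Psh) (f : Hom W X) (g : Hom W psh_tO)
    (e : f >> F = g >> univ_p) : e_lift e >> e_Q = g.
Proof.
apply nt_ext; intros G; apply functional_extensionality; intros w.
apply e_snd_mk.
Qed.

Lemma e_lift_unique (W : Psh) (h h' : Hom W e_psh) :
  h >> e_pr = h' >> e_pr -> h >> e_Q = h' >> e_Q -> h = h'.
Proof.
intros E1 E2; apply nt_ext; intros G; apply functional_extensionality; intros w.
apply e_ext.
- exact (f_equal (fun k : NatTrans W X => k G w) E1).
- exact (f_equal (fun k : NatTrans W psh_tO => k G w) E2).
Qed.

End Extension.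

Definition psh_str : UniverseStructure univ_p :=
  {| cext := e_psh; cpr := e_pr; cQ := e_Q; csquare := e_square;
     lift := e_lift; lift_pr := e_lift_pr; lift_Q := e_lift_Q;
     lift_unique := e_lift_unique |}.

Definition pt_ob (G : CC) : Rp M :=
  existT (Rpn M) 0 (fun m : M => dom m = G /\ codom m = cpt).

Definition pt_map (G' G : CC) (f : Hom G' G) (x : el (pt_ob G)) :
    el (pt_ob G') :=
  exist (fun m : M => dom m = G' /\ codom m = cpt)
    (mor (f >> cast_dom (proj1 (proj2_sig x)) (arr (proj1_sig x))))
    (conj eq_refl (proj2 (proj2_sig x))).

Lemma hom_cpt_eq (G : CC) (f g : Hom G cpt) : f = g.
Proof.
destruct (cpt_final G) as [h [_ hu]].
now rewrite <- (hu f I), <- (hu g I).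
Qed.

Lemma pt_ob_eq (G : CC) (x y : el (pt_ob G)) : x = y.
Proof.
apply el_ext; destruct x as [[A [B a]] [h1 h2]], y as [[A' [B' a']] [h1' h2']].
unfold dom, codom in *; simpl in *; subst A A' B B'.
now rewrite (hom_cpt_eq a a').
Qed.

Definition psh_pt : Psh.
Proof.
refine {| fob := (pt_ob : Op CC -> Rp M);
          fmor := fun (G G' : Op CC) (f : Hom G G') => @pt_map G' G f |}.
- abstract (intros G; apply functional_extensionality; intros x;
    apply pt_ob_eq).
- abstract (intros G G' G'' f g; apply functional_extensionality; intros x;
    apply pt_ob_eq).
Defined.

Fixpoint to_cpt (n : nat) : forall G : CC, len G = n -> Hom G cpt :=
  match n with
  | 0 => fun G e => cast_codom (proj1 (len_eq0 G) e) (idm G)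
  | S n => fun G e =>
      pr G >> to_cpt (n := n)
        (eq_trans (len_ft (eq_ind_r (fun k => 0 < k) (Nat.lt_0_succ n) e))
           (eq_trans (f_equal (fun k => k - 1) e) (Nat.sub_0_r n)))
  end.

Definition pt_el (G : CC) : el (pt_ob G) :=
  exist (fun m : M => dom m = G /\ codom m = cpt)
    (mor (to_cpt (eq_refl (len G)))) (conj eq_refl eq_refl).

Lemma psh_pt_final : IsFinal psh_pt.
Proof.
intros W.
unshelve eexists.
- refine (@Build_NatTrans (Op CC) (Rp M) W psh_pt
            (fun (G : Op CC) _ => pt_el G) _).
  intros G G' f; apply functional_extensionality; intros w; apply pt_ob_eq.
- split; [exact I|]; intros h _.
  apply nt_ext; intros G; apply functional_extensionality; intros w.
  apply pt_ob_eq.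
Qed.

Definition psh_universe : UniverseCategory :=
  {| uc_cat := Psh; uc_Ut := psh_tO; uc_U := psh_O; uc_p := univ_p; uc_str := psh_str;
     uc_pt := psh_pt; uc_pt_final := psh_pt_final |}.

End Presheaves.

(* Main.v *)
From Stdlib Require Import Arith Lia ProofIrrelevance FunctionalExtensionality.
Require Import Defs.

Set Implicit Arguments.
Unset Strict Implicit.

(** The isomorphism is found through its inverse, which sends an object X of
    CC(C,p) to the object of CC that represents the presheaf int(X).

    Such an object exists by induction on the length of X.  The presheaf pt is
    represented by the object pt ([pt_rep]).  Suppose that G represents
    int(X) with universal element u, and let F : int(X) -> O.  Then F(u) is the
    identity of some D in Ob_1(G), and D represents (int(X);F) ([ext_rep]):
    an element of (int(X);F) over G' is an f : G' -> G together with a section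
    of f^*(D), which is the same as a morphism G' -> D because canonical
    squares are pull-backs.  The universal element over D is the pair of
    p_D^*(u) and the diagonal section s_{Id_D}.

    On morphisms the Yoneda lemma makes this assignment fully faithful
    ([rep_hom_full], [rep_hom_faithful]).  It is bijective on objects
    ([rep_ob_inj], [rep_ob_surj]) because, again by Yoneda, F |-> F(u) is a
    bijection from Hom(int(X),O) to Ob_1(G), so that both C-systems have the
    same objects of length n+1 over corresponding objects of length n.  It
    respects p and q because the universal elements do, and it respects s for
    the reason given at [hom_s_of_q].  A homomorphism of C-systems that is
    bijective on objects and fully faithful is an isomorphism
    ([inv_csystem_hom_iso]). *)

(** * Homomorphisms of C-systems and their inverses *)

Lemma len_succ_ft (CC : C0System) (D : CC) :
  0 < len D -> len D = len (ft D) + 1.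
Proof. intros h; rewrite (len_ft h); lia. Qed.

Lemma functor_mor (C D : Category) (T : Functor C D) (X Y X' Y' : C)
    (f : Hom X Y) (f' : Hom X' Y') :
  mor f = mor f' -> mor (fmor T f) = mor (fmor T f').
Proof.
intros E; destruct (mor_eq_inv E) as [e [e' <-]]; now destruct e, e'.
Qed.

(** The s-operation is determined by the C0-structure: the image of s_f is a
    section, hence equal to its own s ([sop_section]), and the axiom relating s
    to the morphisms q rewrites this as the s of the image of f. *)
Lemma hom_s_of_q (CC CC' : CSystem) (T : Functor CC CC')
    (Tft : forall X : CC, T (ft X) = ft (T X))
    (Tpr : forall X : CC, mor (fmor T (pr X)) = mor (pr (T X)))
    (Tq : forall (Y : CC) (hY : 0 < len Y) (hTY : 0 < len (T Y))
      (X : CC) (f : Hom X (ft Y)),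
      mor (fmor T (q hY f)) = mor (q hTY (cast_codom (Tft Y) (fmor T f))))
    (Y : CC) (hY : 0 < len Y) (hTY : 0 < len (T Y)) (X : CC) (f : Hom X Y) :
  mor (fmor T (sop hY f)) = mor (sop hTY (fmor T f)).
Proof.
pose (g := cast_codom (Tft Y) (fmor T (f >> pr Y))).
assert (eD : T (star hY (f >> pr Y)) = star hTY g)
  by exact (f_equal dom (Tq Y hY hTY X (f >> pr Y))).
assert (d : Ob1 (T X) (T (star hY (f >> pr Y)))).
{ rewrite eD; split; [|apply ft_star].
  rewrite <- (ft_star hTY g) at 2; apply len_succ_ft, len_star. }
transitivity (mor (sop (Ob1_pos d) (fmor T (sop hY f)))).
- symmetry; apply sop_section.
  rewrite <- fmor_id, <- (sop_pr hY f), fmor_comp.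
  apply mor_comp; [reflexivity|].
  rewrite <- Tpr; apply functor_mor; now rewrite mor_cast_codom.
- rewrite (sop_comp_q (Ob1_pos d) eD (fmor T (sop hY f))).
  apply sop_eq.
  transitivity (mor (fmor T (sop hY f >> q hY (f >> pr Y)))).
  + rewrite fmor_comp; apply mor_comp; [now rewrite mor_cast_codom|].
    symmetry; apply Tq.
  + now rewrite <- sop_q.
Qed.

Section Inverse.
Variables (CC CC' : CSystem) (T : CSystemHom CC CC').
Hypothesis Tsurj : forall X : CC', {A : CC | T A = X}.
Hypothesis Tinj : forall A B : CC, T A = T B -> A = B.
Hypothesis Tfull : forall (A B : CC) (f : Hom (T A) (T B)), {g | fmor T g = f}.
Hypothesis Tfaithful :
  forall (A B : CC) (f g : Hom A B), fmor T f = fmor T g -> f = g.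

Lemma bij_mor_inj (A B A' B' : CC) (f : Hom A B) (g : Hom A' B') :
  mor (fmor T f) = mor (fmor T g) -> mor f = mor g.
Proof.
intros E.
assert (A = A') as <- by exact (Tinj (f_equal dom E)).
assert (B = B') as <- by exact (Tinj (f_equal codom E)).
f_equal; f_equal; apply Tfaithful; now apply mor_inj.
Qed.

Definition inv_ob (X : CC') : CC := proj1_sig (Tsurj X).

Lemma inv_obK (X : CC') : T (inv_ob X) = X.
Proof. exact (proj2_sig (Tsurj X)). Qed.

Definition inv_hom (X Y : CC') (f : Hom X Y) : Hom (inv_ob X) (inv_ob Y) :=
  proj1_sig (Tfull (cast_dom (eq_sym (inv_obK X))
                      (cast_codom (eq_sym (inv_obK Y)) f))).

Lemma inv_homK (X Y : CC') (f : Hom X Y) : mor (fmor T (inv_hom f)) = mor f.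
Proof.
unfold inv_hom; destruct Tfull as [g E]; simpl; rewrite E.
now rewrite mor_cast_dom, mor_cast_codom.
Qed.

Definition inv_functor : Functor CC' CC.
Proof.
refine {| fob := inv_ob; fmor := inv_hom |}.
- abstract (intros X; apply mor_inj, bij_mor_inj;
    rewrite inv_homK, fmor_id; now rewrite inv_obK).
- abstract (intros X Y Z f g; apply mor_inj, bij_mor_inj;
    rewrite inv_homK, fmor_comp; apply mor_comp; now rewrite inv_homK).
Defined.

Lemma inv_len (X : CC') : len (inv_ob X) = len X.
Proof. rewrite <- (hom_len T); now rewrite inv_obK. Qed.

Lemma inv_ft (X : CC') : inv_ob (ft X) = ft (inv_ob X).
Proof. apply Tinj; rewrite (hom_ft T); now rewrite !inv_obK. Qed.

Lemma inv_pr (X : CC') : mor (inv_hom (pr X)) = mor (pr (inv_ob X)).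
Proof.
apply bij_mor_inj; rewrite inv_homK, (hom_pr T); now rewrite inv_obK.
Qed.

Lemma inv_q (Y : CC') (hY : 0 < len Y) (hIY : 0 < len (inv_ob Y)) (X : CC')
    (f : Hom X (ft Y)) :
  mor (inv_hom (q hY f)) = mor (q hIY (cast_codom (inv_ft Y) (inv_hom f))).
Proof.
apply bij_mor_inj; rewrite inv_homK.
assert (hT : 0 < len (T (inv_ob Y))) by now rewrite inv_obK.
rewrite (hom_q hIY hT); apply q_eq; [now rewrite inv_obK|].
rewrite mor_cast_codom, <- inv_homK.
apply functor_mor; now rewrite mor_cast_codom.
Qed.

Definition inv_csystem_hom : CSystemHom CC' CC :=
  {| hom_functor := inv_functor; hom_len := inv_len; hom_ft := inv_ft;
     hom_pr := inv_pr; hom_q := inv_q;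
     hom_s := hom_s_of_q (T := inv_functor) inv_pr inv_q |}.

Lemma inv_csystem_hom_iso : IsIso inv_csystem_hom.
Proof.
exists T; split; [exact inv_obK|split; [exact inv_homK|split]].
- intros A; apply Tinj, inv_obK.
- intros A B f; apply bij_mor_inj, inv_homK.
Qed.

End Inverse.

(** * Elements of presheaves and representations *)

Section Representation.
Variable CC : CSystem.

Local Notation M := (Mor CC).
Local Notation P := (Psh CC).
Local Notation O := (psh_O CC).

Definition elt (X : P) (G : CC) : Type :=
  el ((X : Functor (Op CC) (Rp M)) G).

Definition res (X : P) (G' G : CC) (f : Hom G' G) (x : elt X G) : elt X G' :=
  fmor (X : Functor (Op CC) (Rp M)) (f : @Hom (Op CC) G G') x.

Definition app (X Y : P) (a : Hom X Y) (G : CC) (x : elt X G) : elt Y G :=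
  (a : NatTrans X Y) G x.

Lemma res_id (X : P) (G : CC) (x : elt X G) : res (idm G) x = x.
Proof.
exact (f_equal (fun k => k x)
  (fmor_id (X : Functor (Op CC) (Rp M)) G)).
Qed.

Lemma res_comp (X : P) (G'' G' G : CC) (g : Hom G'' G') (f : Hom G' G)
    (x : elt X G) : res (g >> f) x = res g (res f x).
Proof.
exact (f_equal (fun k => k x)
  (fmor_comp (X : Functor (Op CC) (Rp M)) (f : @Hom (Op CC) G G') g)).
Qed.

Lemma app_res (X Y : P) (a : Hom X Y) (G' G : CC) (f : Hom G' G)
    (x : elt X G) : app a (res f x) = res f (app a x).
Proof.
exact (f_equal (fun k => k x)
  (nt_natural (a : NatTrans X Y) (f : @Hom (Op CC) G G'))).
Qed.

Lemma app_ext (X Y : P) (a b : Hom X Y) :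
  (forall (G : CC) (x : elt X G), app a x = app b x) -> a = b.
Proof.
intros E; apply nt_ext; intros G; apply functional_extensionality; apply E.
Qed.

(** The classifying morphisms are data rather than asserted to exist uniquely,
    so that the transformation with a given value at the universal element
    ([yo]) is defined without choice. *)
Record Rep (G : CC) (X : P) := {
  runiv : elt X G;
  rclass : forall G' : CC, elt X G' -> Hom G' G;
  res_rclass : forall (G' : CC) (x : elt X G'), res (rclass x) runiv = x;
  rclass_res : forall (G' : CC) (f : Hom G' G), rclass (res f runiv) = f
}.

Lemma rep_inj (G : CC) (X : P) (r : Rep G X) (G' : CC) (f g : Hom G' G) :
  res f (runiv r) = res g (runiv r) -> f = g.
Proof. intros E; now rewrite <- (rclass_res r f), E, rclass_res. Qed.

Section Yoneda.
Variables (G : CC) (X Y : P) (r : Rep G X).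

Definition yo (y : elt Y G) : @Hom P X Y.
Proof.
refine (@Build_NatTrans (Op CC) (Rp M) X Y
          (fun (G' : Op CC) x => res (rclass r (x : elt X G')) y) _).
abstract (intros G1 G2 f; apply functional_extensionality; intros x;
  refine (eq_trans _ (res_comp (f : @Hom CC G2 G1) (rclass r x) y));
  refine (f_equal (fun k => res k y) _);
  apply (rep_inj (r := r)); rewrite res_rclass, res_comp, res_rclass;
  reflexivity).
Defined.

Lemma app_yo (y : elt Y G) : app (yo y) (runiv r) = y.
Proof.
change (res (rclass r (runiv r)) y = y).
rewrite <- (res_id y) at 2; f_equal; apply (rep_inj (r := r)).
now rewrite res_rclass, res_id.
Qed.

Lemma yoneda_ext (a b : Hom X Y) :
  app a (runiv r) = app b (runiv r) -> a = b.
Proof.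
intros E; apply app_ext; intros G' x.
now rewrite <- (res_rclass r x), !app_res, E.
Qed.

End Yoneda.

(** * The universal section over an object *)

Definition o_ob (G : CC) (x : elt O G) : CC := dom (proj1_sig x).

Lemma o_Ob1 (G : CC) (x : elt O G) : Ob1 G (o_ob x).
Proof. exact (Ob1'_dom (proj2_sig x)). Qed.

Lemma o_ext (G : CC) (x y : elt O G) : o_ob x = o_ob y -> x = y.
Proof.
intros E; apply el_ext; destruct x as [m [D [d ->]]], y as [m' [D' [d' ->]]].
exact (f_equal (fun D => mor (idm D)) E).
Qed.

Lemma o_ob_res (G' G : CC) (f : Hom G' G) (x : elt O G) (d : Ob1 G (o_ob x)) :
  o_ob (res f x) = pb1 f d.
Proof. now apply pb1_eq. Qed.

Definition o_mk (G D : CC) (d : Ob1 G D) : elt O G :=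
  exist (Ob1' G) (mor (idm D)) (Ob1'_idm d).

Section Diagonal.
Variables (G D : CC) (d : Ob1 G D).

Definition dpr : Hom D G := cast_codom (proj2 d) (pr D).

(** The section of p_D^*(D) that corresponds to the identity of D. *)
Definition diag : Hom D (star (Ob1_pos d) (idm D >> pr D)) :=
  sop (Ob1_pos d) (idm D).

Lemma diag_codom : star (Ob1_pos d) (idm D >> pr D) = pb1 dpr d.
Proof.
apply star_eq; [reflexivity|].
unfold dpr; now rewrite !mor_cast_codom, comp_id_l.
Qed.

Lemma diag_pr : mor (diag >> pr _) = mor (idm D).
Proof.
etransitivity; [|exact (f_equal mor (sop_pr (Ob1_pos d) (idm D)))].
apply mor_comp; [reflexivity|symmetry; apply mor_cast_codom].
Qed.

Lemma diag_tOb1 : tOb1 D (mor diag).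
Proof.
split; [reflexivity|split; [|exact diag_pr]].
change (Ob1 D (star (Ob1_pos d) (idm D >> pr D))).
rewrite diag_codom; apply pb1_Ob1.
Qed.

Definition diag_elt : elt (psh_tO CC) D := exist (tOb1 D) (mor diag) diag_tOb1.

(** Universality of the diagonal section: its pull-back along g is s_g, by the
    axiom relating s to q applied to g = (g >> s_{Id_D}) >> q(p_D,D). *)
Lemma res_diag (G' : CC) (g : Hom G' D) :
  proj1_sig (res g diag_elt) = mor (sop (Ob1_pos d) g).
Proof.
assert (d' : Ob1 D (star (Ob1_pos d) (idm D >> pr D)))
  by (rewrite diag_codom; apply pb1_Ob1).
transitivity (pb_sec g d' diag).
- refine (pb_sec_mor _ _ _ _); apply mor_sec_of.
- unfold pb_sec.
  rewrite (sop_comp_q (Ob1_pos d') (eq_refl : _ = star (Ob1_pos d) _)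
             (g >> diag)).
  apply sop_eq; simpl cast_codom; rewrite (comp_assoc g).
  transitivity (mor (g >> idm D)); [|now rewrite comp_id_r].
  apply (f_equal (fun k => mor (g >> k))); symmetry; apply sop_q.
Qed.

Definition qd (G' : CC) (f : Hom G' G) : Hom (pb1 f d) D :=
  q (Ob1_pos d) (cast_codom (eq_sym (proj2 d)) f).

Lemma qd_dpr (G' : CC) (f : Hom G' G) :
  mor (qd f >> dpr) =
  mor (pr (pb1 f d) >> cast_dom (eq_sym (proj2 (pb1_Ob1 f d))) f).
Proof.
transitivity (mor (qd f >> pr D)).
- apply mor_comp; [reflexivity|apply mor_cast_codom].
- etransitivity; [exact (f_equal mor (eq_sym (q_pr (Ob1_pos d) _)))|].
  apply mor_comp; now rewrite ?mor_cast_codom, ?mor_cast_dom.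
Qed.

(** This lemma and the next two say that g |-> (g >> p_D, s_g) and
    (f,s) |-> s >> q(f,D) are mutually inverse, where s is a section of
    f^*(D). *)
Lemma section_qd_dpr (G' : CC) (f : Hom G' G) (s : Hom G' (pb1 f d)) :
  mor (s >> pr (pb1 f d)) = mor (idm G') -> (s >> qd f) >> dpr = f.
Proof.
intros hs; apply mor_inj; rewrite comp_assoc.
transitivity
  (mor (s >> (pr (pb1 f d) >> cast_dom (eq_sym (proj2 (pb1_Ob1 f d))) f))).
- apply mor_comp; [reflexivity|apply qd_dpr].
- transitivity (mor (idm G' >> f)); [|now rewrite comp_id_l].
  rewrite <- comp_assoc; apply mor_comp; [exact hs|apply mor_cast_dom].
Qed.

Lemma sop_section_qd (G' : CC) (f : Hom G' G) (s : Hom G' (pb1 f d)) :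
  mor (s >> pr (pb1 f d)) = mor (idm G') ->
  mor (sop (Ob1_pos d) (s >> qd f)) = mor s.
Proof.
intros hs; rewrite <- (sop_section (pb1_Ob1 f d) hs); symmetry.
exact (sop_comp_q (Ob1_pos (pb1_Ob1 f d))
  (eq_refl : pb1 f d = star (Ob1_pos d) _) s).
Qed.

Lemma section_qd_eq (G' : CC) (f : Hom G' G) (s : Hom G' (pb1 f d))
    (g : Hom G' D) :
  f = g >> dpr -> mor s = mor (sop (Ob1_pos d) g) -> s >> qd f = g.
Proof.
intros Ef Es; apply mor_inj.
rewrite (sop_q (Ob1_pos d) g); apply mor_comp; [exact Es|].
apply q_eq; [reflexivity|]; rewrite mor_cast_codom, Ef.
apply mor_comp; [reflexivity|apply mor_cast_codom].
Qed.

End Diagonal.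

(** * Representing the extension of a represented presheaf *)

Section RepExtension.
Variables (G : CC) (X : P) (r : Rep G X) (F : Hom X O).

Let d : Ob1 G (o_ob (app F (runiv r))) := o_Ob1 (app F (runiv r)).

Definition ext_ob : CC := o_ob (app F (runiv r)).

Lemma ext_univ_cond :
  app F (res (dpr d) (runiv r)) = app (univ_p CC) (diag_elt d).
Proof.
apply o_ext; rewrite app_res, (o_ob_res _ d); symmetry; apply diag_codom.
Qed.

Definition ext_univ : elt (e_psh F) ext_ob := e_mk ext_univ_cond.

(** The section in z lives over f^*(D), for f the classifying morphism of the
    first component: this is the condition F(x) = Id_codom(s) on z, read at
    x = f^*(u). *)
Lemma ext_codom (G' : CC) (z : elt (e_psh F) G') :
  codom (proj1_sig (e_snd z)) = pb1 (rclass r (e_fst z)) d.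
Proof.
rewrite <- o_ob_res, <- app_res, res_rclass.
exact (f_equal (@o_ob G') (eq_sym (e_cond z))).
Qed.

Definition ext_section (G' : CC) (z : elt (e_psh F) G') :
    Hom G' (pb1 (rclass r (e_fst z)) d) :=
  cast_codom (ext_codom z) (sec_of (proj2_sig (e_snd z))).

Lemma mor_ext_section (G' : CC) (z : elt (e_psh F) G') :
  mor (ext_section z) = proj1_sig (e_snd z).
Proof. unfold ext_section; now rewrite mor_cast_codom, mor_sec_of. Qed.

Lemma ext_section_pr (G' : CC) (z : elt (e_psh F) G') :
  mor (ext_section z >> pr _) = mor (idm G').
Proof.
rewrite <- (sec_of_pr (proj2_sig (e_snd z))).
apply mor_comp; [apply mor_cast_codom|]; now rewrite ext_codom.
Qed.

Definition ext_class (G' : CC) (z : elt (e_psh F) G') : Hom G' ext_ob :=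
  ext_section z >> qd d (rclass r (e_fst z)).

Lemma e_fst_res_univ (G' : CC) (g : Hom G' ext_ob) :
  e_fst (res g ext_univ) = res (g >> dpr d) (runiv r).
Proof.
rewrite res_comp.
etransitivity; [exact (app_res (e_pr F) g ext_univ)|].
exact (f_equal (res g) (e_fst_mk ext_univ_cond)).
Qed.

Lemma e_snd_res_univ (G' : CC) (g : Hom G' ext_ob) :
  proj1_sig (e_snd (res g ext_univ)) = mor (sop (Ob1_pos d) g).
Proof.
rewrite <- res_diag; f_equal.
etransitivity; [exact (app_res (e_Q F) g ext_univ)|].
exact (f_equal (res (X := psh_tO CC) g) (e_snd_mk ext_univ_cond)).
Qed.

Definition ext_rep : Rep ext_ob (e_psh F).
Proof.
refine {| runiv := ext_univ; rclass := ext_class |}.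
- abstract (intros G' z; apply e_ext;
    [ rewrite e_fst_res_univ; unfold ext_class;
      rewrite section_qd_dpr by apply ext_section_pr; apply res_rclass
    | apply el_ext; rewrite e_snd_res_univ; unfold ext_class;
      rewrite sop_section_qd by apply ext_section_pr; apply mor_ext_section ]).
- abstract (intros G' g; apply section_qd_eq;
    [ rewrite e_fst_res_univ; apply rclass_res
    | rewrite mor_ext_section; apply e_snd_res_univ ]).
Defined.

End RepExtension.

(** * The homomorphism given by representing objects *)

Definition pt_rep : Rep cpt (psh_pt CC).
Proof.
refine {| runiv := (pt_el cpt : elt (psh_pt CC) cpt);
          rclass := fun (G' : CC) _ => to_cpt (eq_refl (len G')) |}.
- abstract (intros; apply pt_ob_eq).
- abstract (intros; apply hom_cpt_eq).
Defined.

Local Notation V := (psh_universe CC).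
Local Notation CV := (CC_of_universe V).

Fixpoint rep_stage (n : nat) :
    forall A : @Obn V n, {G : CC & Rep G (intn A)} :=
  match n return forall A : @Obn V n, {G : CC & Rep G (intn A)} with
  | 0 => fun _ => existT (fun G => Rep G (psh_pt CC)) cpt pt_rep
  | S n => fun AF =>
      existT (fun G => Rep G (e_psh (projT2 AF))) _
        (ext_rep (projT2 (rep_stage (projT1 AF))) (projT2 AF))
  end.

Definition rep_ob (X : CV) : CC := projT1 (rep_stage (projT2 X)).
Definition int_rep (X : CV) : Rep (rep_ob X) (@int V X) :=
  projT2 (rep_stage (projT2 X)).

Definition rep_hom (X Y : CV) (a : Hom X Y) : Hom (rep_ob X) (rep_ob Y) :=
  rclass (int_rep Y)
    (app (a : @Hom P (@int V X) (@int V Y)) (runiv (int_rep X))).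

Lemma res_rep_hom (X Y : CV) (a : Hom X Y) :
  res (rep_hom a) (runiv (int_rep Y)) =
  app (a : @Hom P (@int V X) (@int V Y)) (runiv (int_rep X)).
Proof. apply res_rclass. Qed.

Lemma rep_hom_eq (X Y : CV) (a : Hom X Y) (f : Hom (rep_ob X) (rep_ob Y)) :
  app (a : @Hom P (@int V X) (@int V Y)) (runiv (int_rep X)) =
  res f (runiv (int_rep Y)) -> rep_hom a = f.
Proof. intros E; unfold rep_hom; rewrite E; apply rclass_res. Qed.

Definition rep_functor : Functor CV CC.
Proof.
refine {| fob := rep_ob; fmor := rep_hom |}.
- abstract (intros X; apply rep_hom_eq; symmetry; apply res_id).
- abstract (intros X Y Z a b; apply rep_hom_eq;
    rewrite res_comp, res_rep_hom, <- app_res, res_rep_hom; reflexivity).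
Defined.

Lemma rep_ob_cons (X : CV) (F : @Hom P (@int V X) O) :
  Ob1 (rep_ob X) (rep_ob (@cc_cons V X F)).
Proof. apply o_Ob1. Qed.

Lemma cv_ind (Q : CV -> Prop) :
  Q cpt ->
  (forall (X : CV) (F : @Hom P (@int V X) O), Q X -> Q (@cc_cons V X F)) ->
  forall X : CV, Q X.
Proof.
intros H0 HS [n A]; induction n as [|n IH].
- destruct A; exact H0.
- destruct A as [A F]; exact (HS (existT _ n A) F (IH A)).
Qed.

Lemma ft_cons (X : CV) (F : @Hom P (@int V X) O) :
  ft (@cc_cons V X F : CV) = X.
Proof. now destruct X. Qed.

Lemma rep_ob_len (X : CV) : len (rep_ob X) = len X.
Proof.
induction X as [|X F IH] using cv_ind; [now apply len_eq0|].
rewrite (proj1 (rep_ob_cons F)), IH; exact (Nat.add_1_r _).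
Qed.

Lemma rep_ob_ft (X : CV) : rep_ob (ft X) = ft (rep_ob X).
Proof.
induction X as [|X F _] using cv_ind; [symmetry; apply ft_cpt|].
rewrite ft_cons; symmetry; exact (proj2 (rep_ob_cons F)).
Qed.

(** For positive length the claim is that pulling back u along p_D gives the
    first component of the universal element, which holds by definition of the
    latter; for length 0 both morphisms end in a final object. *)
Lemma rep_hom_pr (X : CV) : mor (rep_hom (pr X)) = mor (pr (rep_ob X)).
Proof.
induction X as [|X F _] using cv_ind.
- transitivity (mor (cast_codom (ft_cpt CC) (pr (@cpt CC))));
    [|apply mor_cast_codom].
  f_equal; f_equal; apply hom_cpt_eq.
- transitivity (mor (dpr (rep_ob_cons F))); [|apply mor_cast_codom].
  destruct X as [n A].
  apply (f_equal mor), rep_hom_eq.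
  etransitivity; [exact (e_fst_mk (ext_univ_cond _ F))|].
  apply (f_equal (fun k => res k _)), (f_equal (@dpr _ _)), proof_irrelevance.
Qed.

Section Reindexing.
Variables (H G : CC) (X Y : V) (rX : Rep H X) (rY : Rep G Y).
Variables (f : Hom X Y) (F : Hom Y (uc_U V)) (g : Hom H G).
Hypothesis fg : app f (runiv rX) = res g (runiv rY).

Let d : Ob1 G (ext_ob rY F) := o_Ob1 (app F (runiv rY)).
Let d' : Ob1 H (ext_ob rX (f >> F)) := o_Ob1 (app (f >> F) (runiv rX)).

Lemma ext_ob_comp : ext_ob rX (f >> F) = pb1 g d.
Proof.
etransitivity; [|exact (o_ob_res g d)].
rewrite <- app_res, <- fg; reflexivity.
Qed.

(** The morphism q(g,D) classifies the transformation Q(f,F).  On first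
    components this is the commutation of the canonical square; on second
    components both sides are s of q(g,D), because the diagonal section over
    g^*(D) is s_Id and the axiom relating s to q rewrites it as
    s_{Id >> q(g,D)}.  The morphism is called h because its domain is only
    propositionally equal to g^*(D). *)
Lemma Q2_ext_univ (h : Hom (ext_ob rX (f >> F)) (ext_ob rY F)) :
  mor h = mor (qd d g) ->
  app (Q2 f F) (ext_univ rX (f >> F)) = res h (ext_univ rY F).
Proof.
intros Eh; apply e_ext.
- rewrite e_fst_res_univ.
  transitivity (app f (e_fst (ext_univ rX (f >> F)))); [apply e_fst_mk|].
  transitivity (app f (res (dpr d') (runiv rX)));
    [apply (f_equal (app (G := _) f)), e_fst_mk|].
  rewrite app_res, fg, <- res_comp.
  f_equal; apply mor_inj; symmetry.
  transitivity (mor (qd d g >> dpr d)); [now apply mor_comp|].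
  rewrite qd_dpr; apply mor_comp; [|apply mor_cast_dom].
  unfold dpr; rewrite mor_cast_codom; now rewrite ext_ob_comp.
- apply el_ext; rewrite e_snd_res_univ.
  transitivity (proj1_sig (e_snd (ext_univ rX (f >> F))));
    [apply f_equal, e_snd_mk|].
  transitivity (mor (diag d')); [reflexivity|]; unfold diag.
  rewrite (sop_comp_q (Ob1_pos d') (ext_ob_comp : _ = star (Ob1_pos d) _)
             (idm _)).
  apply sop_eq; refine (eq_trans _ (eq_sym Eh)).
  transitivity (mor (idm (pb1 g d) >> qd d g)); [|now rewrite comp_id_l].
  apply mor_comp; [|reflexivity].
  rewrite mor_cast_codom; now rewrite ext_ob_comp.
Qed.

End Reindexing.

Lemma rep_hom_q (Y : CV) (hY : 0 < len Y) (hTY : 0 < len (rep_ob Y)) (X : CV)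
    (f : Hom X (ft Y)) :
  mor (rep_hom (q hY f)) = mor (q hTY (cast_codom (rep_ob_ft Y) (rep_hom f))).
Proof.
destruct Y as [[|n] A]; [exfalso; exact (Nat.lt_irrefl 0 hY)|].
destruct A as [A F].
pose (B := existT _ n A : CV); change (@Hom CV X B) in f.
pose (d := o_Ob1 (app F (runiv (int_rep B)))).
pose (E := ext_ob_comp F (eq_sym (res_rep_hom f))).
transitivity (mor (cast_dom (eq_sym E) (qd d (rep_hom f)))).
- apply (f_equal mor), rep_hom_eq.
  apply (Q2_ext_univ (eq_sym (res_rep_hom f))); apply mor_cast_dom.
- rewrite mor_cast_dom; apply q_eq; [reflexivity|].
  now rewrite !mor_cast_codom.
Qed.

Definition rep_csystem_hom : CSystemHom CV CC :=
  {| hom_functor := rep_functor; hom_len := rep_ob_len; hom_ft := rep_ob_ft;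
     hom_pr := rep_hom_pr; hom_q := rep_hom_q;
     hom_s := hom_s_of_q (T := rep_functor) rep_hom_pr rep_hom_q |}.

Lemma rep_hom_full (X Y : CV) (f : Hom (rep_ob X) (rep_ob Y)) :
  {a : Hom X Y | rep_hom a = f}.
Proof.
exists (yo (int_rep X) (res f (runiv (int_rep Y)))).
apply rep_hom_eq, app_yo.
Qed.

Lemma rep_hom_faithful (X Y : CV) (a b : Hom X Y) :
  rep_hom a = rep_hom b -> a = b.
Proof.
intros E; apply (yoneda_ext (r := int_rep X)).
rewrite <- !res_rep_hom; now rewrite E.
Qed.

(** An extension (X,F) is sent to the object D with F(u) = Id_D, so
    ft(D) determines X by induction, and then Yoneda recovers F from F(u). *)
Lemma rep_ob_inj (X Y : CV) : rep_ob X = rep_ob Y -> X = Y.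
Proof.
revert Y; induction X as [|X F IH] using cv_ind; intros Y;
  induction Y as [|Y F' _] using cv_ind; intros E.
- reflexivity.
- apply (f_equal (@len CC)) in E; rewrite !rep_ob_len in E; discriminate E.
- apply (f_equal (@len CC)) in E; rewrite !rep_ob_len in E; discriminate E.
- assert (X = Y) as <-.
  { apply IH; rewrite <- (ft_cons F), <- (ft_cons F'), !rep_ob_ft.
    now rewrite E. }
  f_equal; apply (yoneda_ext (r := int_rep X)), o_ext; exact E.
Qed.

(** If X is sent to ft(G), the transformation int(X) -> O with u |-> Id_G
    extends X to an object sent to G. *)
Lemma rep_ob_surj (n : nat) :
  forall G : CC, len G = n -> {X : CV | rep_ob X = G}.
Proof.
induction n as [|n IH]; intros G e.
- exists (cpt : CV); symmetry; now apply len_eq0.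
- assert (hG : 0 < len G) by lia.
  destruct (IH (ft G)) as [X E]; [rewrite (len_ft hG); lia|].
  assert (d : Ob1 (rep_ob X) G)
    by (rewrite E; split; [now apply len_succ_ft|easy]).
  exists (@cc_cons V X (yo (int_rep X) (o_mk d))).
  exact (f_equal (@o_ob (rep_ob X)) (app_yo (int_rep X) (o_mk d))).
Qed.

End Representation.

Theorem mainTheorem5 (CC : CSystem) :
  exists H : CSystemHom CC (CC_of_universe (psh_universe CC)), IsIso H.
Proof.
eexists; apply (inv_csystem_hom_iso (T := rep_csystem_hom CC)
  (fun G => rep_ob_surj (eq_refl (len G))) (@rep_ob_inj CC)
  (@rep_hom_full CC) (@rep_hom_faithful CC)).
Qed.
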